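(* (i) The partially ordered set $(\mathbf E,\subseteq)$ is a completely distributive complete lattice, with union as join, intersection as meet, $\emptyset$ as bottom and $\overline{\mathbf D}$ as top. (ii) The partially ordered set $(\mathbf E_{\mathrm{fin}},\subseteq)$ is a bounded distributive lattice, with union as join, intersection as meet, $\emptyset$ as bottom and $\overline{\mathbf D}$ as top. (iii) The partially ordered set $(\hat{\mathbf E}_{\mathrm{fin}},\subseteq)$ is a bounded distributive lattice, with union as join, intersection as meet, $\emptyset$ as bottom and $\overline{\mathbf D}$ as top.
   Context: Let $\mathcal T$ be a non-empty set (of ''things''), $\mathrm{cl}:\mathcal P(\mathcal T)\to\mathcal P(\mathcal T)$ a closure operator (extensive, monotone, idempotent), $\mathcal T_-\subseteq\mathcal T$ a set of forbidden things, $\mathcal T_+:=\mathrm{cl}(\emptyset)$, with the standing assumption $\mathcal T_+\cap\mathcal T_-=\emptyset$. A coherent SDT is a $D\subseteq\mathcal T$ with $\mathrm{cl}(D)=D$ and $D\cap\mathcal T_-=\emptyset$; $\overline{\mathbf D}$ is the set of all coherent SDTs. $\mathcal Q(\mathcal T)$ denotes the set of finite subsets of $\mathcal T$ (including $\emptyset$). For $S\subseteq\mathcal T$ let $\overline{\mathbf D}_S:=\{D\in\overline{\mathbf D}:S\cap D\neq\emptyset\}$, and for $\mathcal W\subseteq\mathcal P(\mathcal T)$ let $E(\mathcal W):=\bigcap_{S\in\mathcal W}\overline{\mathbf D}_S$ (so $E(\emptyset)=\overline{\mathbf D}$). Let $\mathbf E:=\{E(\mathcal W):\mathcal W\subseteq\mathcal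 P(\mathcal T)\}$, $\mathbf E_{\mathrm{fin}}:=\{E(\mathcal W):\mathcal W\subseteq\mathcal P(\mathcal T)\text{ finite}\}$ and $\hat{\mathbf E}_{\mathrm{fin}}:=\{E(\mathcal V):\mathcal V\subseteq\mathcal Q(\mathcal T)\text{ finite}\}$. *)

(* Defs.v *)
From HB Require Import structures.
From mathcomp Require Import all_boot all_order.
From mathcomp Require Import boolp classical_sets cardinality.

Set Implicit Arguments.
Unset Strict Implicit.
Unset Printing Implicit Defensive.

Local Open Scope classical_set_scope.

Definition closure_operator {T : Type} (cl : set T -> set T) : Prop :=
  [/\ forall A : set T, A `<=` cl A,
      forall A B : set T, A `<=` B -> cl A `<=` cl B
    & forall A : set T, cl (cl A) = cl A].

Definition Tplus {T : Type} (cl : set T -> set T) : set T := cl set0.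

Definition Dbar {T : Type} (cl : set T -> set T) (Tminus : set T) :
    set (set T) :=
  [set D | cl D = D /\ D `&` Tminus = set0].

(* Events are subsets of the type of coherent sets of desirable things (SDTs), *)
(* so that [setT] is the set of all of them, and so is an intersection of no   *)
(* events.                                                                     *)
Section Events.
Context {T : Type} (cl : set T -> set T) (Tminus : set T).

Definition DbarS (S : set T) : set (Dbar cl Tminus) :=
  [set D : Dbar cl Tminus | S `&` val D !=set0].

Definition E (W : set (set T)) : set (Dbar cl Tminus) :=
  \bigcap_(S in W) DbarS S.

Definition bfE : set (set (Dbar cl Tminus)) :=
  [set E W | W in [set: set (set T)]].

Definition bfEfin : set (set (Dbar cl Tminus)) :=
  [set E W | W in [set W : set (set T) | finite_set W]].

Definition bfEhatfin : set (set (Dbar cl Tminus)) :=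
  [set E V | V in [set V : set (set T) |
                    V `<=` [set S | finite_set S] /\ finite_set V]].

End Events.

Arguments DbarS {T} cl Tminus S.
Arguments E {T} cl Tminus W.
Arguments bfE {T} cl Tminus.
Arguments bfEfin {T} cl Tminus.
Arguments bfEhatfin {T} cl Tminus.

Definition inclusion_lattice {X : Type} {d} (L : tbLatticeType d)
    (v : L -> set X) : Prop :=
  [/\ forall a b : L, (a <= b)%O <-> v a `<=` v b,
      forall a b : L, v (Order.join a b) = v a `|` v b,
      forall a b : L, v (Order.meet a b) = v a `&` v b,
      v \bot%O = set0
    & v \top%O = [set: X] ].

Definition complete_lattice {d} (L : porderType d) (Sup Inf : set L -> L) :
    Prop :=
  forall A : set L, supremums A (Sup A) /\ infimums A (Inf A).

(* Meets distribute over joins, for arbitrary doubly indexed families; the     *)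
(* inner index type [J i] may depend on [i], and [I] and [J i] may be empty.   *)
Definition completely_distributive {d} (L : porderType d)
    (Sup Inf : set L -> L) : Prop :=
  forall (I : Type) (J : I -> Type) (x : forall i : I, J i -> L),
    Inf [set Sup (range (x i)) | i in [set: I]] =
    Sup [set Inf (range (fun i => x i (f i))) | f in [set: forall i, J i] ].

(* A lattice structure on a family [F] of sets is a class [c] of the library's *)
(* lattice structures over the carrier [F] itself.                             *)
Definition bounded_distributive_lattice_of_sets {X : Type}
    (F : set (set X)) : Prop :=
  exists c : Order.TBDistrLattice.axioms_ set_display F,
    inclusion_lattice (L := Order.TBDistrLattice.Pack c)
      (fun a : F => val a).

Definition completely_distributive_complete_lattice_of_sets {X : Type}
    (F : set (set X)) : Prop :=
  exists c : Order.TBLattice.axioms_ set_display F,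
    let L : tbLatticeType set_display := Order.TBLattice.Pack c in
    inclusion_lattice (L := L) (fun a : F => val a) /\
    exists Sup Inf : set L -> L,
      [/\ complete_lattice Sup Inf,
          completely_distributive Sup Inf,
          forall A : set L, val (Sup A : F) = \bigcup_(a in A) val (a : F)
        & forall A : set L, val (Inf A : F) = \bigcap_(a in A) val (a : F)].

(* Main.v *)
(* Intersections of events are again events because [E] turns unions of        *)
(* families into intersections.  For unions, distributing the union over the   *)
(* intersections gives [E V `|` E W = E {R `|` S | R in V, S in W}], and in    *)
(* general an event indexed by the unions of all choice functions; both        *)
(* preserve the finiteness conditions in the binary case.  The three families  *)
(* are therefore (complete) rings of sets, and complete distributivity is      *)
(* inherited from the powerset.                                                *)

Require Import Defs.
From HB Require Import structures.
From mathcomp Require Import all_boot all_order.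
From mathcomp Require Import boolp classical_sets cardinality.

Import Order.TTheory.

Local Open Scope classical_set_scope.

(** An event [E W] is the conjunction, over [S] in [W], of the conditions that [D] meets [S].
    Conjunctions of events pool their families ([E_bigcup], [E_setU]). Disjunctions return to this
    conjunctive form by distributivity, since meeting [R] or meeting [S] amounts to meeting their
    union ([bigcup_E], [setU_E]). Each class of events is thus a ring of sets, complete for [bfE],
    and takes its lattice laws from the powerset; the infinite law is [bigcap_bigcup_choice]. *)

Lemma tbSubLattice_distr {d d'} {T : tbDistrLatticeType d} {P : pred T}
    (U : Order.TBSubLattice.type P d') :
  exists c : Order.TBDistrLattice.axioms_ d' U,
  let L := Order.TBDistrLattice.Pack c in
  [/\ forall a b : L, (a <= b)%O = (val a <= val b)%O,
      forall a b : L, val (Order.join a b) = Order.join (val a) (val b),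
      forall a b : L, val (Order.meet a b) = Order.meet (val a) (val b),
      val (\bot%O : L) = \bot%O
    & val (\top%O : L) = \top%O].
Proof.
have valI (a b : U) : val (Order.meet a b) = Order.meet (val a) (val b).
  exact: Order.valI_subproof.
have valU (a b : U) : val (Order.join a b) = Order.join (val a) (val b).
  exact: Order.valU_subproof.
(* Distributivity is an equation in meets and joins, so the injective morphism [val] reflects it
   from [T] to [U]. *)
have meetUl : @left_distributive U U Order.meet Order.join.
  by move=> a b c; apply: val_inj; rewrite !(valI, valU) meetUl.
pose distr := Order.Lattice_Meet_isDistrLattice.Build _ U meetUl.
pose L : tbDistrLatticeType d' := HB.pack U distr.
exists (Order.TBDistrLattice.class L); split=> /=.
- by move=> a b; rewrite [RHS]Order.le_val.
- exact: Order.valU_subproof.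
- exact: Order.valI_subproof.
- exact: Order.val0_subproof.
- exact: Order.val1_subproof.
Qed.

Lemma closed_bounded_distributive_lattice {X : Type} (F : set (set X)) :
  F set0 -> F [set: X] -> (forall A B, F A -> F B -> F (A `&` B)) ->
  (forall A B, F A -> F B -> F (A `|` B)) ->
  bounded_distributive_lattice_of_sets F.
Proof.
move=> F0 FT FI FU.
pose P : pred (set X) := fun A => A \in F.
have PI A B : P A -> P B -> P (Order.meet A B) by rewrite /P !inE; exact: FI.
have PU A B : P A -> P B -> P (Order.join A B) by rewrite /P !inE; exact: FU.
have P0 : P \bot%O by rewrite /P inE.
have P1 : P \top%O by rewrite /P inE.
pose sub := Order.SubChoice_isTBSubLattice.Build _ _ P set_display {A | P A}
  PI PU P0 P1.
pose U : Order.TBSubLattice.type P set_display := HB.pack {A | P A} sub.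
have [c [le_val valU valI val0 val1]] := tbSubLattice_distr U.
exists c; split=> // a b.
by rewrite le_val subsetEset.
Qed.

(** Left to right this is the axiom of choice: a point on the left selects a [j] for every [i]. If
    some [J i] is empty, there is no [f] and both sides are empty. *)
Lemma bigcap_bigcup_choice {X I : Type} {J : I -> Type}
    (x : forall i, J i -> set X) :
  \bigcap_i \bigcup_j x i j =
  \bigcup_(f in [set: forall i, J i]) \bigcap_i x i (f i).
Proof.
apply/seteqP; split=> [t xt|t [f _ xt] i _]; last by exists (f i); last exact: xt.
have {}xt i : {j | x i j t} by apply: cid; have [j _ ?] := xt i Logic.I; exists j.
by exists (fun i => sval (xt i)) => // i _; exact: svalP (xt i).
Qed.

Lemma closed_completely_distributive_lattice {X : Type} (F : set (set X)) :
  (forall A, A `<=` F -> F (\bigcup_(a in A) a)) ->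
  (forall A, A `<=` F -> F (\bigcap_(a in A) a)) ->
  completely_distributive_complete_lattice_of_sets F.
Proof.
move=> FU FI.
have val_sub (A : set F) : val @` A `<=` F by move=> _ [a _ <-]; exact: set_valP.
have FbigU (A : set F) : \bigcup_(a in A) val a \in F.
  by rewrite inE -(bigcup_image A val id); exact: FU.
have FbigI (A : set F) : \bigcap_(a in A) val a \in F.
  by rewrite inE -(bigcap_image A val id); exact: FI.
(* Bottom and top are the empty union and the empty intersection; the binary operations are the case
   of a pair. *)
have [| | | |c lattice_c] := @closed_bounded_distributive_lattice X F.
- by rewrite -(bigcup_set0 id); apply: FU.
- by rewrite -(bigcap_set0 id); apply: FI.
- move=> A B FA FB; rewrite -(bigcap_set1 id B) -bigcap_setU1.
  by apply: FI => _ [->|->].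
- move=> A B FA FB; rewrite -(bigcup_set1 id B) -bigcup_setU1.
  by apply: FU => _ [->|->].
exists (Order.TBLattice.class (Order.TBDistrLattice.Pack c)) => L; split => //.
exists (fun A => exist (fun B => B \in F) _ (FbigU A)).
exists (fun A => exist (fun B => B \in F) _ (FbigI A)).
have [leP _ _ _ _] := lattice_c.
split => //.
- move=> A; split; split=> [a Aa|b ubb]; apply/leP => //=.
  + exact: bigcup_sup.
  + by apply: bigcup_sub => a Aa; apply/leP; exact: ubb.
  + exact: bigcap_inf.
  + by apply: sub_bigcap => a Aa; apply/leP; exact: ubb.
- move=> I J x; apply: val_inj => /=.
  rewrite (bigcap_image _ _ val) (bigcup_image _ _ val) /=.
  under eq_bigcapr do rewrite (bigcup_image _ _ val).
  under eq_bigcupr do rewrite (bigcap_image _ _ val).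
  exact: bigcap_bigcup_choice.
Qed.

Section Events.
Context {T : Type} (cl : set T -> set T) (Tminus : set T).

Local Notation DbarS := (DbarS cl Tminus).
Local Notation E := (E cl Tminus).

Lemma E_set1 (S : set T) : E [set S] = DbarS S.
Proof. exact: bigcap_set1. Qed.

Lemma DbarS0 : DbarS set0 = set0.
Proof. by rewrite -subset0 => D [x []]. Qed.

Lemma E_set0 : E set0 = setT.
Proof. exact: bigcap_set0. Qed.

Lemma E_setU (V W : set (set T)) : E (V `|` W) = E V `&` E W.
Proof. exact: bigcap_setU. Qed.

Lemma E_bigcup {I : Type} (P : set I) (W : I -> set (set T)) :
  E (\bigcup_(i in P) W i) = \bigcap_(i in P) E (W i).
Proof.
apply/seteqP; split=> [D ED i Pi S WS|D ED S [i Pi WS]]; last exact: ED WS.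
by apply: ED; exists i.
Qed.

(** If [D] lies in no [E (W i)], choose in each [W i] a set that [D] misses; then [D] misses their
    union, a member of the family on the right. *)
Lemma bigcup_E {I : Type} (P : set I) (W : I -> set (set T)) :
  \bigcup_(i in P) E (W i) =
  E [set \bigcup_(i in P) s i |
      s in [set s : I -> set T | forall i, P i -> W i (s i)]].
Proof.
apply/seteqP; split=> [D [i Pi ED] _ [s Ws <-]|D ED].
  by have [x [sx Dx]] := ED _ (Ws _ Pi); exists x; split=> //; exists i.
apply: contrapT => nED.
have /choice [s sP] i : exists S, P i -> W i S /\ ~ DbarS S D.
  (* Choice functions are total on [I], so [set0] is a dummy value outside [P]. *)
  have [Pi|nPi] := pselect (P i); last by exists set0.
  have /existsNP[S /not_implyP[WS nS]] : ~ E (W i) D by move=> ?; apply: nED; exists i.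
  by exists S.
have [|x [[i Pi sx] Dx]] := ED (\bigcup_(i in P) s i).
  by exists s => // i /sP[].
by have [_ []] := sP i Pi; exists x.
Qed.

Lemma setU_E (V W : set (set T)) :
  E V `|` E W = E [set R `|` S | R in V & S in W].
Proof.
apply/seteqP; split=> [D [ED|ED] _ [R VR [S WS <-]]|D ED].
- by have [x [Rx Dx]] := ED R VR; exists x; split=> //; left.
- by have [x [Sx Dx]] := ED S WS; exists x; split=> //; right.
apply: contrapT => /not_orP[] /existsNP[R /not_implyP[VR nR]].
move=> /existsNP[S /not_implyP[WS nS]].
have [|x [[Rx|Sx] Dx]] := ED (R `|` S); first by exists R => //; exists S.
- by apply: nR; exists x.
- by apply: nS; exists x.
Qed.

End Events.

Theorem theorem3 (T : Type) (cl : set T -> set T) (Tminus : set T)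
    (T_neq0 : [set: T] !=set0)
    (cl_closure : closure_operator cl)
    (Tplus_Tminus : Tplus cl `&` Tminus = set0) :
  [/\ completely_distributive_complete_lattice_of_sets (bfE cl Tminus),
      bounded_distributive_lattice_of_sets (bfEfin cl Tminus)
    & bounded_distributive_lattice_of_sets (bfEhatfin cl Tminus)].
Proof.
split.
(* Taking every [W] with [E W] in [A] indexes [A] without choosing a representative for each
   event. *)
- have sub_image A : A `<=` bfE cl Tminus ->
      A = E cl Tminus @` [set W | A (E cl Tminus W)].
    move=> AE; apply/seteqP; split=> [a Aa|_ [W AW <-]//].
    by have [W _ EWa] := AE a Aa; exists W; rewrite //= EWa.
  apply: closed_completely_distributive_lattice => A /sub_image ->.
  + by rewrite bigcup_image bigcup_E; eexists.
  + by rewrite bigcap_image -E_bigcup; eexists.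
- apply: closed_bounded_distributive_lattice.
  + by exists [set set0]; rewrite ?E_set1 ?DbarS0//; exact: finite_set1.
  + by exists set0; rewrite ?E_set0//; exact: finite_set0.
  + move=> _ _ [V fV <-] [W fW <-]; exists (V `|` W); rewrite ?E_setU//.
    by rewrite /= finite_setU.
  + move=> _ _ [V fV <-] [W fW <-]; rewrite setU_E; eexists; last by [].
    exact: finite_image2.
- apply: closed_bounded_distributive_lattice.
  + exists [set set0]; rewrite ?E_set1 ?DbarS0//; split; last exact: finite_set1.
    by move=> _ ->; exact: finite_set0.
  + by exists set0; rewrite ?E_set0//; split; [exact: sub0set|exact: finite_set0].
  + move=> _ _ [V [VQ fV] <-] [W [WQ fW] <-]; exists (V `|` W); rewrite ?E_setU//.
    by split; [rewrite subUset|rewrite finite_setU].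
  + move=> _ _ [V [VQ fV] <-] [W [WQ fW] <-]; rewrite setU_E; eexists; last by [].
    split; last exact: finite_image2.
    (* The members of the new family are the unions of [R] and [S], finite because both are. *)
    move=> _ [R VR [S WS <-]]; rewrite /= finite_setU.
    by split; [exact: VQ|exact: WQ].
Qed.
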